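(* Let $I$, $X$ and $Y$ be infinite in-trees in which every vertex has finitely many predecessors. If $I \star X \cong I \star Y$, then $X \cong Y$.
   Context: An in-tree (anti-arborescence) is a rooted directed tree in which all edges are directed towards the root: the root has no outgoing edge, every other vertex $v$ has exactly one outgoing edge, and following outgoing edges from any vertex one reaches the root after finitely many steps. The predecessors of $v$ are the vertices $u$ such that $(u,v)$ is an edge. An in-tree is infinite if it has infinitely many vertices. Product of in-trees: for in-trees $I_1=(\mathcal V_1,\mathcal E_1)$ and $I_2=(\mathcal V_2,\mathcal E_2)$ (finite or infinite) with roots $r_1$ and $r_2$, the in-tree $I_1\star I_2=(\mathcal V,\mathcal E)$ is defined as follows. $\mathcal V$ is the smallest subset of $\mathcal V_1\times\mathcal V_2$ containing $(r_1,r_2)$ and such that whenever $(v,u)\in\mathcal V$, $(v',v)\in\mathcal E_1$ and $(u',u)\in\mathcal E_2$, also $(v',u')\in\mathcal V$. The edges are the pairs $((v',u'),(v,u))$ of vertices in $\mathcal V$ with $(v',v)\in\mathcal E_1$ and $(u',u)\in\mathcal E_2$. The root of $I_1\star I_2$ is $(r_1,r_2)$. The symbol $\cong$ denotes isomorphism of directed graphs. *)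

(* Defs.v *)
From Stdlib Require Export Relation_Operators.
From mathcomp Require Export all_boot.
From mathcomp Require Export boolp classical_sets functions cardinality.

Set Implicit Arguments.
Unset Strict Implicit.
Unset Printing Implicit Defensive.

Local Open Scope classical_set_scope.

Record digraph := Digraph {
  vertex :> Type;
  edge : vertex -> vertex -> Prop }.

Definition digraph_iso (G H : digraph) : Prop :=
  exists f : G -> H,
    bijective f /\ (forall u v : G, edge u v <-> edge (f u) (f v)).

Notation "G \cong H" := (digraph_iso G H) (at level 70, no associativity).

Record in_tree := InTree {
  in_tree_digraph :> digraph;
  root : in_tree_digraph;
  root_no_out : forall w : in_tree_digraph, ~ edge root w;
  unique_out : forall v : in_tree_digraph, v <> root -> exists! w, edge v w;
  reach_root : forall v : in_tree_digraph, clos_refl_trans_1n _ (@edge _) v root }.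

Definition predecessors (G : digraph) (v : G) : set G := [set u | edge u v].

Definition locally_finite (G : digraph) : Prop :=
  forall v : G, finite_set (predecessors v).

Definition infinite_digraph (G : digraph) : Prop := infinite_set [set: G].

Section Product.
Variables I1 I2 : in_tree.

Inductive star_vertex : I1 * I2 -> Prop :=
| star_vertex_root : star_vertex (root I1, root I2)
| star_vertex_step (v v' : I1) (u u' : I2) :
    star_vertex (v, u) -> edge v' v -> edge u' u -> star_vertex (v', u').

Definition star_digraph : digraph :=
  @Digraph {p : I1 * I2 | star_vertex p}
    (fun p q => edge (sval p).1 (sval q).1 /\ edge (sval p).2 (sval q).2).

Definition star_root : star_digraph :=
  exist star_vertex (root I1, root I2) star_vertex_root.

Lemma out_unique (I : in_tree) (v w w' : I) : edge v w -> edge v w' -> w = w'.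
Proof.
move=> vw vw'; have [vr|vr] := pselect (v = root I).
  by rewrite vr in vw; case: (root_no_out vw).
have [x [_ xu]] := unique_out vr.
by rewrite -(xu _ vw) -(xu _ vw').
Qed.

Lemma star_root_no_out (q : star_digraph) : ~ edge star_root q.
Proof. by case=> /root_no_out. Qed.

Lemma star_unique_out (p : star_digraph) :
  p <> star_root -> exists! q, edge p q.
Proof.
case: p => p Vp; case: Vp (Vp) => [|v v' u u' Vvu v'v u'u] Vp.
  by case; exact: eq_exist.
move=> _; exists (exist star_vertex (v, u) Vvu); split=> // -[[w t] Vwt] [/= vw ut].
by apply: eq_exist; rewrite (out_unique v'v vw) (out_unique u'u ut).
Qed.

Lemma star_reach_root (p : star_digraph) :
  clos_refl_trans_1n _ (@edge _) p star_root.
Proof.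
case: p => p Vp; move: (Vp); elim: Vp => [|v v' u u' Vvu IH v'v u'u] Vp.
  by rewrite (Prop_irrelevance Vp star_vertex_root); exact: rt1n_refl.
exact: (@Relation_Operators.rt1n_trans _ _ _ (exist star_vertex (v, u) Vvu)).
Qed.

Definition star : in_tree :=
  InTree star_root_no_out star_unique_out star_reach_root.

End Product.

Notation "I1 \star I2" := (star I1 I2) (at level 40, left associativity).

(* Main.v *)
Require Import Defs.
From HB Require Import structures.
From mathcomp Require Import ssralg ssrnum ssrint ring.

(** Count level-preserving homomorphisms: for a finite rooted tree [t] and a
    vertex [v], let [hom t v] be the number of maps from [t] to the digraph
    that send the root of [t] to [v] and edges to edges.  Since [I \star X]
    is the categorical product of rooted trees, [hom t] at its root equals
    [hom t (root I) * hom t (root X)] ([hom_star]).  The tree [I] is infinite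
    and locally finite, so it has an infinite branch, on which every [t] can be
    folded; hence [hom t (root I)] is positive ([hom_gt0]) and can be
    cancelled: an isomorphism [I \star X \cong I \star Y] forces
    [hom t (root X) = hom t (root Y)] for all [t].

    These numbers determine a locally finite in-tree ([hom_equivalent_iso]).
    Indeed, for fixed [v], the function [t |-> hom t v] turns the operation of
    merging two trees at their roots into a product: it is a character of the
    monoid of finite trees.  Evaluating at a tree whose root has one child
    shows that if [x] and [y] have the same counts, then the characters of the
    predecessors of [x] and those of the predecessors of [y] have the same sum.
    By Dedekind's linear independence of characters the two families agree with
    multiplicities, that is, some bijection between the predecessors preserves
    all the counts ([hom_equivalent_preds]).  Starting from the roots and
    applying these bijections level by level yields the isomorphism
    ([matched_iso]). *)

Import GRing.Theory Num.Theory.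
Set Implicit Arguments.
Unset Strict Implicit.
Unset Printing Implicit Defensive.
Local Open Scope ring_scope.

(** * Linear independence of characters *)

Section Characters.
Variables (R : idomainType) (M : Type) (mul : M -> M -> M) (e : M).

Definition multiplicative (phi : M -> R) : Prop :=
  phi e = 1 /\ forall m n, phi (mul m n) = phi m * phi n.

(** Dedekind's argument: if [psi] and [phi] differ at [n], subtracting
    [psi n] times the relation at [m] from the relation at [mul n m] removes
    [psi] and multiplies the coefficient of [phi] by [phi n - psi n]. *)
Lemma characters_independent (s : seq (M -> R)) (c : (M -> R) -> R) :
    uniq s -> (forall phi, phi \in s -> multiplicative phi) ->
    (forall m, \sum_(phi <- s) c phi * phi m = 0) ->
  forall phi, phi \in s -> c phi = 0.
Proof.
elim: s c => [//|psi s IHs] c /= /andP[psiNs us] chi_s sum0.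
have c_s phi : phi \in s -> c phi = 0.
  move=> phis; have [n phin] : exists n, phi n != psi n.
    apply: contrapT => eqn; move/negP: psiNs; apply; suff -> : psi = phi by [].
    apply/funext => n; apply: contrapT => neq; apply: eqn.
    by exists n; apply/eqP => eq; apply: neq.
  have /eqP : c phi * (phi n - psi n) = 0.
    apply: (IHs (fun phi => c phi * (phi n - psi n))) => // [chi chis|m].
      by apply: chi_s; rewrite inE chis orbT.
    have := sum0 (mul n m); have := sum0 m; rewrite !big_cons => sm snm.
    have -> : \sum_(chi <- s) c chi * (chi n - psi n) * chi m
        = \sum_(chi <- s) c chi * chi (mul n m)
          - psi n * \sum_(chi <- s) c chi * chi m.
      rewrite big_distrr -sumrB; apply: eq_big_seq => chi chis /=.
      have [_ ->] := chi_s chi (mem_behead (s := psi :: s) chis).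
      by ring.
    move/eqP: sm; rewrite addrC addr_eq0 => /eqP ->.
    move/eqP: snm; rewrite addrC addr_eq0 => /eqP ->.
    have [_ ->] := chi_s psi (mem_head _ _).
    by rewrite mulrN opprK !mulrA [psi n * _]mulrC addNr.
  by rewrite mulf_eq0 subr_eq0 (negPf phin) orbF => /eqP.
move=> phi; rewrite inE => /orP[/eqP ->|/c_s//].
have := sum0 e; rewrite big_cons big1_seq => [|chi /andP[_ /c_s ->]]; last by rewrite mul0r.
by rewrite addr0; have [-> _] := chi_s psi (mem_head _ _); rewrite mulr1.
Qed.

Lemma sum_count_mem (T : eqType) (F : T -> R) (s w : seq T) :
    uniq w -> {subset s <= w} ->
  \sum_(x <- s) F x = \sum_(x <- w) (count_mem x s)%:R * F x.
Proof.
move=> uw; elim: s => [|a s IHs] sw /=.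
  by rewrite big_nil big1 // => x _; rewrite mul0r.
rewrite big_cons IHs => [|x xs]; last by apply: sw; rewrite inE xs orbT.
under [RHS]eq_bigr do rewrite natrD mulrDl.
rewrite big_split /=; congr (_ + _).
rewrite (bigD1_seq a) ?sw ?mem_head //= eqxx mul1r big1 ?addr0 // => x xa.
by rewrite eq_sym (negPf xa) mul0r.
Qed.

End Characters.

(** In characteristic zero, the multiplicities of the characters in a sum can be
    read off from the sum, because the differences of multiplicities are the
    coefficients of a vanishing linear combination. *)
Lemma perm_eq_characters (R : numDomainType) (M : Type) (mul : M -> M -> M) (e : M)
    (s t : seq (M -> R)) :
    (forall phi, phi \in s ++ t -> multiplicative mul e phi) ->
    (forall m, \sum_(phi <- s) phi m = \sum_(phi <- t) phi m) ->
  perm_eq s t.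
Proof.
move=> chi sum_eq; apply/allP => phi phist /=.
have sumE m r : {subset r <= s ++ t} -> \sum_(psi <- r) psi m =
    \sum_(psi <- undup (s ++ t)) (count_mem psi r)%:R * psi m.
  move=> rst; apply: sum_count_mem => [|psi /rst]; first exact: undup_uniq.
  by rewrite mem_undup.
have := @characters_independent R M mul e (undup (s ++ t))
  (fun psi => (count_mem psi s)%:R - (count_mem psi t)%:R).
move=> /(_ (undup_uniq _)) H.
have /eqP : (count_mem phi s)%:R - (count_mem phi t)%:R = 0 :> R.
  apply: H => [psi|m|]; [by rewrite mem_undup; exact: chi| |by rewrite mem_undup].
  under eq_bigr do rewrite mulrBl.
  by rewrite sumrB -!sumE ?sum_eq ?subrr // => psi; rewrite mem_cat => ->; rewrite ?orbT.
by rewrite subr_eq0 eqr_nat.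
Qed.

(** * Bijections from equality of multisets *)

Lemma perm_map_lift (A B C : eqType) (f : A -> C) (g : B -> C)
    (s : seq A) (t : seq B) (b0 : B) :
    uniq s -> perm_eq (map f s) (map g t) ->
  exists2 h : A -> B, perm_eq (map h s) t & {in s, forall a, g (h a) = f a}.
Proof.
elim: s t => [|a s IHs] t /=.
  by move=> _ /perm_size/esym/eqP; rewrite size_map size_eq0 => /eqP ->; exists (fun=> b0).
move=> /andP[aNs us] fsgt.
have /mapP[b bt fab] : f a \in map g t by rewrite -(perm_mem fsgt) mem_head.
have /(IHs _ us)[h hs gh] : perm_eq (map f s) (map g (rem b t)).
  rewrite -(perm_cons (f a)) (perm_trans fsgt) // fab -map_cons.
  by apply: perm_map; exact: perm_to_rem.
exists (fun x => if x == a then b else h x).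
  have /eq_in_map -> : {in s, (fun x => if x == a then b else h x) =1 h}.
    by move=> x xs; case: eqP xs aNs => // -> ->.
  rewrite eqxx.
  by rewrite (perm_trans _ (_ : perm_eq (b :: rem b t) t)) ?perm_cons // perm_sym perm_to_rem.
move=> x; rewrite inE; case: eqP => [-> _|_ /= /gh //]; by rewrite fab.
Qed.

Lemma uniq_map_inj_in (A B : eqType) (h : A -> B) (s : seq A) :
  uniq (map h s) -> {in s &, injective h}.
Proof.
elim: s => [//|a s IHs] /= /andP[haNs us] x y; rewrite !inE.
move=> /orP[/eqP ->|xs] /orP[/eqP ->|ys] hxy //; last exact: IHs.
- by rewrite hxy map_f in haNs.
- by rewrite -hxy map_f in haNs.
Qed.

(** * Counting homomorphisms from finite trees *)

(* Classical choice structures, so that vertices can be listed and summed over. *)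
HB.instance Definition _ (G : digraph) := gen_eqMixin (vertex G).
HB.instance Definition _ (G : digraph) := gen_choiceMixin (vertex G).

Definition preds (G : digraph) (v : G) : seq G :=
  finmap.enum_fset (fset_set (predecessors v)).

Lemma preds_uniq (G : digraph) (v : G) : uniq (preds v).
Proof. exact: finmap.fset_uniq. Qed.

Lemma predsP (G : digraph) (G_fin : locally_finite G) (u v : G) :
  reflect (edge u v) (u \in preds v).
Proof. by rewrite in_fset_set //; apply: (iffP idP); rewrite inE. Qed.

(** Finite rooted plane trees in first-child, next-sibling form: [Leaf] is a
    single vertex, and [Graft t r] is [r] with [t] attached as a new first child
    of the root.  The order of the children does not affect the counts below;
    this binary encoding makes plain structural recursion sufficient. *)
Inductive ptree := Leaf | Graft (t r : ptree).

(** Identification of the two roots; a monoid law with unit [Leaf]. *)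
Fixpoint merge t s :=
  if t is Graft t1 t2 then Graft t1 (merge t2 s) else s.

(** The number of homomorphisms from [t] to a locally finite [G] with root sent to
    [v]: each child of the root independently picks a predecessor of [v].  The
    values are taken in a ring in order to apply the independence of characters. *)
Fixpoint hom (G : digraph) (t : ptree) (v : G) : int :=
  if t is Graft t1 t2 then (\sum_(u <- preds v) hom t1 u) * hom t2 v else 1.

Lemma hom_multiplicative (G : digraph) (v : G) :
  multiplicative merge Leaf (fun t => hom t v).
Proof.
by split=> // t s; elim: t => [|t1 _ t2 IH] /=; rewrite ?mul1r // IH mulrA.
Qed.

Lemma hom_iso (G H : digraph) (G_fin : locally_finite G) (H_fin : locally_finite H)
    (f : G -> H) (f_bij : bijective f)
    (f_edge : forall u v, edge u v <-> edge (f u) (f v)) (t : ptree) (v : G) :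
  hom t (f v) = hom t v.
Proof.
elim: t v => [//|t1 IH1 t2 IH2] v /=; rewrite {}IH2; congr (_ * _).
have -> : \sum_(u <- preds (f v)) hom t1 u = \sum_(u <- map f (preds v)) hom t1 u.
  apply: perm_big; apply: uniq_perm; first exact: preds_uniq.
    by rewrite map_inj_uniq ?preds_uniq //; exact: bij_inj.
  move=> w; apply/predsP/mapP => // [|[u /predsP uv ->]]; last exact/f_edge/uv.
  have [g fK gK] := f_bij; exists (g w); last by rewrite gK.
  by apply/predsP => //; apply/f_edge; rewrite gK.
by rewrite big_map; apply: eq_bigr => u _.
Qed.

Lemma star_sval_inj (I X : in_tree) : injective (fun p : I \star X => sval p).
Proof. by move=> [p Vp] [q Vq] /= pq; exact: eq_exist. Qed.

Lemma star_locally_finite (I X : in_tree) :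
  locally_finite I -> locally_finite X -> locally_finite (I \star X).
Proof.
move=> I_fin X_fin p.
apply: (@sub_finite_set _ _ (sval @^-1`
  (predecessors (sval p).1 `*` predecessors (sval p).2))%classic) => //.
apply: finite_preimage; last exact: finite_setX.
by move=> q r _ _; exact: star_sval_inj.
Qed.

(** The predecessors of a vertex [(v, u)] of the product are all pairs of a
    predecessor of [v] and one of [u], so the sum over them factors. *)
Lemma hom_star (I X : in_tree) (I_fin : locally_finite I) (X_fin : locally_finite X)
    (t : ptree) (p : I \star X) :
  hom t p = hom t (sval p).1 * hom t (sval p).2.
Proof.
elim: t p => [|t1 IH1 t2 IH2] p /=; first by rewrite mulr1.
rewrite {}IH2 mulrACA; congr (_ * _).
rewrite big_distrlr /= -(big_allpairs (F := fun q => hom t1 q.1 * hom t1 q.2)).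
under eq_bigr do rewrite IH1.
rewrite -(big_map sval xpredT (fun q => hom t1 q.1 * hom t1 q.2)).
have star_fin := star_locally_finite I_fin X_fin.
apply: perm_big; apply: uniq_perm.
- by rewrite (map_inj_uniq (@star_sval_inj I X)) preds_uniq.
- by rewrite allpairs_uniq ?preds_uniq // => -[? ?] [? ?].
move=> [u x]; apply/(@mapP (vertex (I \star X)))/allpairsP.
  move=> [[[w y] Vwy] /predsP /= e [-> ->]].
  by case: (e star_fin) => /= ? ?; exists (w, y); split=> //; exact/predsP.
move=> [[w y] [/= /predsP-/(_ I_fin) wp /predsP-/(_ X_fin) yp ->]].
case: p wp yp => -[v z] Vvz /= wp yp.
exists (exist _ (w, y) (star_vertex_step Vvz wp yp)) => //.
exact/predsP.
Qed.

Lemma hom_ge0 (G : digraph) (t : ptree) (v : G) : 0 <= hom t v.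
Proof.
by elim: t v => [//|t1 IH1 t2 IH2] v /=; rewrite mulr_ge0 ?sumr_ge0.
Qed.

Definition descendants (G : digraph) (v : G) : set G :=
  [set u | clos_refl_trans_1n G (@edge G) u v]%classic.

Lemma descendants_last_edge (G : digraph) (u v : G) : descendants v u ->
  u = v \/ exists2 w, edge w v & descendants w u.
Proof.
elim=> {u v} [u|u y v uy _ [<-|[w wv yw]]]; first by left.
- by right; exists u => //; exact: rt1n_refl.
- right; exists w => //; exact: rt1n_trans uy yw.
Qed.

(** The step of König's lemma: finitely many predecessors with finitely many
    descendants each would leave only finitely many descendants of [v]. *)
Lemma infinite_descendants (G : digraph) (G_fin : locally_finite G) (v : G) :
    infinite_set (descendants v) ->
  exists2 u, edge u v & infinite_set (descendants u).
Proof.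
move=> v_inf; apply: contrapT => no_u; apply: v_inf.
have: finite_set ([set v] `|` \bigcup_(u in predecessors v) descendants u)%classic.
  rewrite finite_setU; split; first exact: finite_set1.
  apply: bigcup_finite => // u uv; apply: contrapT => u_inf.
  by apply: no_u; exists u.
apply: sub_finite_set => u /descendants_last_edge[->|[w wv uw]]; first by left.
by right; exists w.
Qed.

Lemma hom_gt0 (G : digraph) (G_fin : locally_finite G) (t : ptree) (v : G) :
  infinite_set (descendants v) -> 0 < hom t v.
Proof.
elim: t v => [//|t1 IH1 t2 IH2] v v_inf /=; rewrite mulr_gt0 ?IH2 //.
have [u uv u_inf] := infinite_descendants G_fin v_inf.
rewrite (bigD1_seq u) ?preds_uniq //=; last exact/predsP.
by rewrite ltr_pwDl ?IH1 // sumr_ge0 // => w _; exact: hom_ge0.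
Qed.

(** * Reconstructing an in-tree from its homomorphism counts *)

Definition hom_equivalent (X Y : digraph) (x : X) (y : Y) : Prop :=
  forall t, hom t x = hom t y.

(** The count from [Graft t Leaf] at [x] is the sum over the predecessors of [x]
    of the counts from [t], so equality of characters at [x] and [y] passes to
    the sums of characters over their predecessors, hence to these characters
    themselves up to a permutation. *)
Lemma hom_equivalent_preds (X Y : digraph)
    (X_fin : locally_finite X) (Y_fin : locally_finite Y)
    (x : X) (y : Y) :
    hom_equivalent x y ->
  exists s : X -> Y, set_bij (predecessors x) (predecessors y) s /\
    forall x', edge x' x -> hom_equivalent x' (s x').
Proof.
move=> xy.
have perm_homs : perm_eq [seq (fun t => hom t x') | x' <- preds x]
                         [seq (fun t => hom t y') | y' <- preds y].
  apply: (perm_eq_characters (mul := merge) (e := Leaf)).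
    move=> phi; rewrite mem_cat => /orP[] /mapP[v _ ->]; exact: hom_multiplicative.
  by move=> t; rewrite !big_map; have /= := xy (Graft t Leaf); rewrite !mulr1.
have [s perm_s s_hom] := perm_map_lift y (preds_uniq x) perm_homs.
have mem_s := perm_mem perm_s.
exists s; split=> [|x' x'x t]; last first.
  have /s_hom /(congr1 (fun phi => phi t)) //: x' \in preds x by exact/predsP.
split.
- move=> x' x'x; apply/predsP => //; rewrite -mem_s map_f //; exact/predsP.
- move=> u v; rewrite !inE => ux vx.
  apply: (uniq_map_inj_in (s := preds x)); try exact/predsP.
  by rewrite (perm_uniq perm_s) preds_uniq.
- move=> y' /predsP-/(_ Y_fin); rewrite -mem_s => /mapP[x' /predsP x'x ->].
  by exists x' => //; exact: x'x.
Qed.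

Section Matching.
Variables (X Y : in_tree) (s : X -> Y -> X -> Y).

(** The graph of the map built downwards from the roots, where [s x y] says how to
    send the predecessors of [x] to those of [y].  As a relation it avoids
    recursion on paths to the root, and bijectivity is proved like functionality
    and totality, with the trees exchanged. *)
Inductive matched : X -> Y -> Prop :=
| matched_root : matched (root X) (root Y)
| matched_step x y x' :
    matched x y -> edge x' x -> matched x' (s x y x').

Hypothesis s_bij : forall x y, matched x y ->
  set_bij (predecessors x) (predecessors y) (s x y).

(** In an in-tree the outgoing edge is unique, so the last step of a derivation
    of [matched x' y'] must go through the given [x]. *)
Lemma matched_edge x x' y' : matched x' y' -> edge x' x ->
  exists y, [/\ matched x y, edge y' y & y' = s x y x'].
Proof.
case=> [|w y {}x' wy x'w] x'x; first by case: (root_no_out x'x).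
exists y; rewrite (out_unique x'x x'w); split=> //.
by have [s_fun _ _] := s_bij wy; exact: s_fun.
Qed.

Lemma matched_edge_inv y x' y' : matched x' y' -> edge y' y ->
  exists x, [/\ matched x y, edge x' x & y' = s x y x'].
Proof.
case=> [|x z {}x' xz x'x] y'y; first by case: (root_no_out y'y).
have [s_fun _ _] := s_bij xz.
by exists x; rewrite (out_unique y'y (s_fun _ x'x)).
Qed.

Lemma matched_functional x y z : matched x y -> matched x z -> y = z.
Proof.
move=> xy; elim: xy z => [|{}x {}y x' xy IH x'x] z.
  move E : (root X) => r rz; case: rz E => [//|w v x' _ x'w E].
  by rewrite -E in x'w; case: (root_no_out x'w).
by move=> /matched_edge-/(_ _ x'x)[v [/IH -> _ ->]].
Qed.

Lemma matched_injective x w y : matched x y -> matched w y -> x = w.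
Proof.
move=> xy; elim: xy w => [|{}x {}y x' xy IH x'x] w.
  move E : (root Y) => r wr; case: wr E => [//|v z w' vz w'v E].
  have [s_fun _ _] := s_bij vz.
  by have := s_fun _ w'v; rewrite /= -E => /root_no_out.
have [s_fun s_inj _] := s_bij xy.
move=> /matched_edge_inv-/(_ _ (s_fun _ x'x))[v [/IH <- wx]].
by apply: s_inj; rewrite inE.
Qed.

Lemma matched_total x : exists y, matched x y.
Proof.
have := reach_root x; move E : (root X) => r xr.
elim: xr E => {x r} [x <-|x w r xw _ IH /IH[y wy]].
  by exists (root Y); exact: matched_root.
by exists (s w y x); exact: matched_step.
Qed.

Lemma matched_surjective y : exists x, matched x y.
Proof.
have := reach_root y; move E : (root Y) => r yr.
elim: yr E => {y r} [y <-|y z r yz _ IH /IH[x xz]].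
  by exists (root X); exact: matched_root.
have [_ _ /(_ y yz)[w wx <-]] := s_bij xz.
by exists w; exact: matched_step.
Qed.

(** The bijections at matched vertices make the relation [matched] the graph of a
    bijection; it preserves and reflects edges because a matched pair other than
    the roots arises from its matched successors. *)
Lemma matched_iso : X \cong Y.
Proof.
have [f fP] := choice matched_total; have [g gP] := choice matched_surjective.
exists f; split.
  exists g => [x|y]; first exact: matched_injective (gP _) (fP _).
  exact: matched_functional (fP _) (gP _).
move=> u v; split=> [uv|fuv].
  have [y [vy uy _]] := matched_edge (fP u) uv.
  by rewrite (matched_functional (fP v) vy).
have [x [xv ux _]] := matched_edge_inv (fP u) fuv.
by rewrite (matched_injective (fP v) xv).
Qed.

End Matching.

Lemma hom_equivalent_iso (X Y : in_tree)
    (X_fin : locally_finite X) (Y_fin : locally_finite Y) :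
  hom_equivalent (root X) (root Y) -> X \cong Y.
Proof.
move=> rXY.
have /choice[s sP] : forall p : X * Y, exists s : X -> Y, hom_equivalent p.1 p.2 ->
    set_bij (predecessors p.1) (predecessors p.2) s /\
    forall x', edge x' p.1 -> hom_equivalent x' (s x').
  move=> [x y]; have [xy|nxy] := pselect (hom_equivalent x y).
    by have [s sP] := hom_equivalent_preds X_fin Y_fin xy; exists s.
  by exists (fun=> y).
(* Matched vertices have the same counts, so the chosen maps are bijections there. *)
apply: (@matched_iso _ _ (fun x y => s (x, y))) => x y xy.
suff /(sP (x, y))[] : hom_equivalent x y by [].
elim: xy => // {}x {}y x' _ xy x'x.
by have [_] := sP (x, y) xy; exact.
Qed.

(** The root is the only vertex without outgoing edge. *)
Lemma iso_root (X Y : in_tree) (f : X -> Y) :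
    bijective f -> (forall u v, edge u v <-> edge (f u) (f v)) ->
  f (root X) = root Y.
Proof.
move=> [g fK gK] f_edge; apply: contrapT => /unique_out[w [+ _]].
by rewrite -(gK w) => /f_edge /root_no_out.
Qed.

Lemma infinite_descendants_root (I : in_tree) :
  infinite_digraph I -> infinite_set (descendants (root I)).
Proof.
suff -> : descendants (root I) = [set: I]%classic by [].
by apply/seteqP; split=> // v _; exact: reach_root.
Qed.

Theorem theorem3p9 (I X Y : in_tree)
    (I_inf : infinite_digraph I) (X_inf : infinite_digraph X)
    (Y_inf : infinite_digraph Y)
    (I_fin : locally_finite I) (X_fin : locally_finite X)
    (Y_fin : locally_finite Y) :
  I \star X \cong I \star Y -> X \cong Y.
Proof.
move=> [f [f_bij f_edge]]; apply: hom_equivalent_iso => // t.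
have IX_fin := star_locally_finite I_fin X_fin.
have IY_fin := star_locally_finite I_fin Y_fin.
have := hom_iso IX_fin IY_fin f_bij f_edge t (root (I \star X)).
rewrite (iso_root f_bij f_edge) !hom_star //=.
move=> /mulfI ->//.
by rewrite lt0r_neq0 ?hom_gt0 //; exact: infinite_descendants_root.
Qed.
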